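(* Let $b\geq2$ and $d\geq1$ be integers and let $\alpha_{\mathrm{crit}}(d,b):=d-1+\log_b(b-1)$. For every $n\geq1$, the leaf set $$A:=W^n\times\underbrace{\Lambda_b^n\times\cdots\times\Lambda_b^n}_{d-1\text{ times}}\subset\partial\Gamma_{(n,\ldots,n)}^{(b)},\qquad W=\{0,1,\ldots,b-2\}\subset\Lambda_b,$$ has cardinality $|A|=(b-1)^nb^{(d-1)n}=b^{\alpha_{\mathrm{crit}}(d,b)n}$, and $\mathrm{Split}_d^{(b)}(A)=\emptyset$.
   Context: For an integer $b\geq 2$ let $\Lambda_b=\{0,1,\ldots,b-1\}$, and let $T_n^{(b)}=\Lambda_b^{\leq n}$ be the set of words of length at most $n$ over $\Lambda_b$, ordered by $u\preceq v$ iff $u$ is a prefix of $v$. The level $|u|$ is the word length and $\partial T_n^{(b)}=\Lambda_b^n$. For $\mathbf n=(n_1,\ldots,n_d)\in\mathbb{Z}_{\geq0}^d$ let $\Gamma_{\mathbf n}^{(b)}=T_{n_1}^{(b)}\times\cdots\times T_{n_d}^{(b)}$ with the coordinatewise prefix order $\preceq_d$, and $\partial\Gamma_{\mathbf n}^{(b)}=\partial T_{n_1}^{(b)}\times\cdots\times\partial T_{n_d}^{(b)}$. For $A\subset\partial\Gamma_{\mathbf n}^{(b)}$ let $\Gamma_A=\{\mathbf u\in\Gamma_{\mathbf n}^{(b)}:\mathbf u\preceq_d\mathbf x\text{ for some }\mathbf x\in A\}$. A vertex $\mathbf u=(u_1,\ldots,u_d)\in\Gamma_A$ with $|u_i|<n_i$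 for all $i$ splits if $(u_1\epsilon_1,\ldots,u_d\epsilon_d)\in\Gamma_A$ for every $(\epsilon_1,\ldots,\epsilon_d)\in\Lambda_b^d$; $\mathrm{Split}_d^{(b)}(A)$ is the set of all vertices of $\Gamma_A$ that split. *)

(* Defs.v *)
From mathcomp Require Import all_boot all_order all_algebra.
From mathcomp Require Import reals exp.

Set Implicit Arguments.
Unset Strict Implicit.
Unset Printing Implicit Defensive.

Import Order.TTheory GRing.Theory Num.Theory.

Local Open Scope nat_scope.

(* Digits are 'I_b, the tree T_n is the type n.-bseq 'I_b of words of length
   at most n, and Gamma b d nn is the product of the trees T_(nn i), i < d. *)
Notation Gamma b d nn :=
  {dffun forall i : 'I_d, (nn i).-bseq 'I_b} (only parsing).

Section ProductTree.

Variables (b d : nat) (nn : 'I_d -> nat).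

Implicit Types (u v x : Gamma b d nn) (A : {set Gamma b d nn}).

Definition prefix_d u v : bool := [forall i, prefix (u i) (v i)].

Definition leaves : {set Gamma b d nn} :=
  [set x : Gamma b d nn | [forall i, size (x i) == nn i]].

Definition down A : {set Gamma b d nn} :=
  [set u : Gamma b d nn | [exists x in A, prefix_d u x]].

(* insub_bseq returns the empty word on words longer than nn i, so [child] is
   the intended vertex only when size (u i) < nn i for every i; [splitting]
   imposes this. *)
Definition child u (e : {ffun 'I_d -> 'I_b}) : Gamma b d nn :=
  [ffun i => insub_bseq (nn i) (rcons (u i) (e i))].

Definition splitting A : {set Gamma b d nn} :=
  [set u : Gamma b d nn | [&& u \in down A, [forall i, size (u i) < nn i]
     & [forall e : {ffun 'I_d -> 'I_b}, child u e \in down A]]].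

End ProductTree.

(* D^n, for a set of digits D. *)
Definition words b (D : {set 'I_b}) n : {set n.-bseq 'I_b} :=
  [set w : n.-bseq 'I_b | (size w == n) && all [in D] w].

Definition W b : {set 'I_b} := [set a : 'I_b | a <= b - 2].

Definition extremal b d n : {set Gamma b d (fun=> n)} :=
  setXn (fun i : 'I_d =>
    if i == 0 :> nat then words (W b) n else words [set: 'I_b] n).

Local Open Scope ring_scope.

Definition logb (R : realType) (b x : R) : R := ln x / ln b.

Definition alpha_crit (R : realType) (d b : nat) : R :=
  d%:R - 1 + logb b%:R (b%:R - 1).

(* Main.v *)
Require Import Defs.
From mathcomp Require Import all_boot all_order all_algebra.
From mathcomp Require Import reals exp.

(** The leaf set is a product of sets of words, so its cardinality is a product
    of powers ([card_words], [card_extremal]); taking logarithms in base [b]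
    turns [(b - 1) ^ n * b ^ ((d - 1) * n)] into [b] to the power
    [alpha_crit * n] ([powR_alpha_crit]).

    No vertex splits because the digit [b - 1] never occurs in the first
    coordinate of a leaf of the set, nor therefore in that of any vertex below
    the set.  A splitting vertex would have the child obtained by appending
    [b - 1] in every coordinate, whose first coordinate contains that digit
    ([splitting_eq0]).  One missing digit in a single coordinate is thus enough,
    and this is why the other coordinates can be left free. *)

Import Order.TTheory GRing.Theory Num.Theory.

(** Words of length exactly [n] over [D] are the [n]-tuples over the subtype
    [{x | x \in D}], which are counted by [card_tuple]. *)
Lemma card_words b (D : {set 'I_b}) n : #|words D n| = #|D| ^ n.
Proof.
pose f (t : n.-tuple {x | x \in D}) : n.-bseq 'I_b := map_tuple val t.
have f_inj : injective f.
  by move=> s t /(congr1 val) /= /(inj_map val_inj) st; apply: val_inj.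
have -> : words D n = f @: setT.
  apply/setP=> w; rewrite inE; apply/idP/imsetP => [/andP[sz_w wD]|[t _ ->]].
    have sz_s : size (pmap (insub : _ -> option {x | x \in D}) w) == n.
      by rewrite size_pmap_sub; move: wD; rewrite all_count => /eqP ->.
    exists (Tuple sz_s) => //; apply: val_inj => /=.
    rewrite pmap_filter; last exact: insubK.
    apply: esym; apply/all_filterP; apply: sub_all wD => x xD.
    by rewrite isSome_insub.
  rewrite /= size_map size_tuple eqxx /=.
  by apply/allP=> _ /mapP[x _ ->]; exact: valP x.
by rewrite card_imset // cardsT card_tuple card_sig.
Qed.

Lemma card_W b : 2 <= b -> #|W b| = b - 1.
Proof.
case: b => [|[|k]] // _.
have -> : W k.+2 = [set~ ord_max].
  apply/setP=> a; rewrite !inE -val_eqE /= subn2 /=.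
  by rewrite -ltnS ltn_neqAle -[a <= _]ltnS ltn_ord andbT.
by rewrite cardsC1 card_ord subn1.
Qed.

Lemma card_extremal b d n : 2 <= b -> 1 <= d ->
  #|extremal b d n| = (b - 1) ^ n * b ^ ((d - 1) * n).
Proof.
move=> hb; case: d => // d _; rewrite cardsXn big_ord_recl /= card_words card_W //.
rewrite !subn1 /= (eq_bigr (fun=> b ^ n)) => [|i _].
  by rewrite prod_nat_const card_ord -expnM (mulnC n).
by rewrite card_words cardsT card_ord.
Qed.

Lemma extremal_leaves b d n : extremal b d n \subset leaves b (fun _ : 'I_d => n).
Proof.
apply/subsetP=> x /setXnP xE; rewrite inE; apply/forallP=> i.
by have := xE i; case: ifP => _; rewrite inE => /andP[].
Qed.

(** The exponent splits into [d - 1], which gives the factor [b ^ (d - 1)], and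
    the logarithm of [b - 1], which gives the factor [b - 1]; both are then
    raised to the power [n]. *)
Lemma powR_alpha_crit (R : realType) (b d n : nat) : 2 <= b -> 1 <= d ->
  (((b - 1) ^ n * b ^ ((d - 1) * n))%:R = powR b%:R (alpha_crit R d b * n%:R) :> R)%R.
Proof.
move=> hb hd.
have b_gt0 : (0 < b%:R :> R)%R by rewrite ltr0n ltnW.
have b1_gt0 : (0 < b%:R - 1 :> R)%R by rewrite subr_gt0 ltr1n.
have lnb_neq0 : (ln b%:R != 0 :> R)%R by rewrite gt_eqF // ln_gt0 // ltr1n.
have powR_logb : (powR b%:R (logb b%:R (b%:R - 1)) = b%:R - 1 :> R)%R.
  by rewrite /powR gt_eqF // divfK // lnK.
rewrite powRrM powR_mulrn ?powR_ge0 // /alpha_crit powRD; last first.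
  by rewrite (gt_eqF b_gt0) implybT.
have -> : (d%:R - 1 = (d - 1)%:R :> R)%R by rewrite natrB.
rewrite powR_logb powR_mulrn ?ler0n // natrM !natrX natrB; last exact: ltnW.
by rewrite exprMn exprM mulrC.
Qed.

(** The child of [u] along the constant tuple [a] has [a] in its [i]-th
    coordinate, and digits pass from a vertex to the leaves above it. *)
Lemma splitting_eq0 b d (nn : 'I_d -> nat)
    (A : {set Gamma b d nn}) (i : 'I_d) (a : 'I_b) :
  (forall x, x \in A -> a \notin (x i : seq 'I_b)) -> splitting A = set0.
Proof.
move=> aA; apply/setP=> u; rewrite !inE; apply/negP=> /and3P[_ /forallP u_lt].
move=> /forallP /(_ [ffun=> a]); rewrite inE => /exists_inP[x xA].
move=> /forallP /(_ i) /prefixP[s x_i]; move: (aA x xA).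
rewrite -[_ \in _]/(a \in (x i : seq _)) x_i !ffunE /insub_bseq val_insubd.
by rewrite size_rcons u_lt mem_cat mem_rcons in_cons eqxx.
Qed.

Theorem mainTheorem7 (R : realType) (b d : nat) (hb : (2 <= b)%N)
    (hd : (1 <= d)%N) (n : nat) (hn : (1 <= n)%N) :
  extremal b d n \subset leaves b (fun _ : 'I_d => n) /\
  #|extremal b d n| = ((b - 1) ^ n * b ^ ((d - 1) * n))%N /\
  (#|extremal b d n|%:R = powR b%:R (alpha_crit R d b * n%:R) :> R)%R /\
  splitting (extremal b d n) = set0.
Proof.
split; first exact: extremal_leaves.
split; first exact: card_extremal.
split; first by rewrite card_extremal // powR_alpha_crit.
have lt_b1 : b - 1 < b by rewrite subn1 ltn_predL ltnW.
apply: (@splitting_eq0 _ _ _ _ (Ordinal hd) (Ordinal lt_b1)) => x /setXnP.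
move=> /(_ (Ordinal hd)); rewrite inE => /andP[_ /allP xW].
apply/negP=> /xW; rewrite inE /= leqNgt => /negP; apply.
by rewrite ltn_sub2l.
Qed.
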